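(* Assume $\mathrm{NP}\neq\mathrm{co\text{-}NP}$. Then there exists a family $\mathcal{F}$ of unsatisfiable subset sum instances $(K,S)$ (so no subset of $S$ sums to exactly $K$) whose associated Pseudo-Boolean constraints do not admit polynomial-size ROBDDs, independently of the variable ordering: there is no polynomial $p$ such that for every $(K,S)\in\mathcal{F}$ there is a variable ordering for which the ROBDD of the associated Pseudo-Boolean constraint has at most $p(|(K,S)|)$ nodes, where $|(K,S)|$ is the bit length of the instance.
   Context: A subset sum instance $(K,S)$ consists of a finite set $S=\{a_1,\dots,a_n\}$ of positive integers and an integer $K$, all written in binary; it is satisfiable if some subset of $S$ sums to exactly $K$, and unsatisfiable (UNSAT) otherwise. Its associated Pseudo-Boolean (PB) constraint is $a_1x_1+\dots+a_nx_n\le K$ with Boolean ($0/1$) variables $x_1,\dots,x_n$, viewed as a Boolean function of $x_1,\dots,x_n$ (value 1 exactly on the assignments satisfying the inequality). For a fixed ordering of the variables, the ROBDD (reduced ordered binary decision diagram) of a Boolean function is its unique ordered BDD in which no node has two identical children and no two distinct nodes root isomorphic subdiagrams. The size of a BDD is its number of nodes. *)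

(* Defs.v *)
From HB Require Import structures.
From mathcomp Require Import all_boot all_order all_algebra finmap.
From mathcomp Require Import boolp classical_sets.

Set Implicit Arguments.
Unset Strict Implicit.
Unset Printing Implicit Defensive.

Import Order.TTheory GRing.Theory Num.Theory.

Local Open Scope classical_set_scope.
Local Open Scope nat_scope.

(** * Nondeterministic multitape Turing machines, NP and coNP *)

Inductive move := MoveLeft | Stay | MoveRight.

(* A two-way infinite tape.  [tleft] and [tright] list the cells next to the
   head, nearest first; all cells beyond these lists are blank. *)
Record tape (A : Type) := Tape { tleft : seq A; tcur : A; tright : seq A }.

Definition tape_move (A : Type) (blank : A) (m : move) (t : tape A) : tape A :=
  match m with
  | MoveLeft =>
      Tape (behead (tleft t)) (head blank (tleft t)) (tcur t :: tright t)
  | Stay => t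
  | MoveRight =>
      Tape (tcur t :: tleft t) (head blank (tright t)) (behead (tright t))
  end.

Definition tape_write (A : Type) (a : A) (t : tape A) : tape A :=
  Tape (tleft t) a (tright t).

(* The tape alphabet consists of the blank [None], the two input symbols
   [Some (inl b)] and finitely many auxiliary symbols [Some (inr a)]. *)
Definition symbol (aux : finType) := option (bool + aux).

(* The machine has [ntapes.+1] tapes.  [trans q r q' w] says that in state [q],
   reading [r i] on each tape [i], the machine may enter state [q'] and, on
   each tape [i], write the symbol [(w i).1] and perform the move [(w i).2]. *)
Record ntm := NTM {
  state : finType;
  aux : finType;
  ntapes : nat;
  start : state;
  accept : state;
  trans : state -> {ffun 'I_ntapes.+1 -> symbol aux} ->
          state -> {ffun 'I_ntapes.+1 -> symbol aux * move} -> bool }.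

Record config (M : ntm) := Config {
  cstate : state M;
  ctapes : {ffun 'I_(ntapes M).+1 -> tape (symbol (aux M))} }.

Definition input_tape (aux : finType) (x : seq bool) : tape (symbol aux) :=
  let w := [seq Some (inl b) | b <- x] in Tape [::] (head None w) (behead w).

Definition init_config (M : ntm) (x : seq bool) : config M :=
  Config (start M)
    [ffun i => if i == ord0 then input_tape (aux M) x else Tape [::] None [::]].

Definition step (M : ntm) (c c' : config M) : Prop :=
  exists q w,
    trans (cstate c) [ffun i => tcur (ctapes c i)] q w /\
    c' = Config q
           [ffun i => tape_move None (w i).2 (tape_write (w i).1 (ctapes c i))].

Fixpoint reaches (M : ntm) (n : nat) (c c' : config M) : Prop :=
  if n is m.+1 then exists2 d, step c d & reaches m d c' else c = c'.

Definition accepts_in (M : ntm) (x : seq bool) (n : nat) : Prop :=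
  exists2 c, reaches n (init_config M x) c & cstate c = accept M.

Definition language := set (seq bool).

(* Every polynomial bound on a function of natural numbers is dominated by one
   with natural coefficients. *)
Definition NP : set language :=
  [set L | exists (M : ntm) (p : {poly nat}),
     (forall x, L x <-> exists n, accepts_in M x n) /\
     (forall x, L x -> exists2 n, n <= p.[size x]%R & accepts_in M x n)].

Definition coNP : set language := [set L | NP (~` L)].

(** * Reduced ordered binary decision diagrams *)

Inductive bdd_node (V N : Type) :=
  | Terminal of bool
  | Decision of V & N & N. (* variable, child for 0, child for 1 *)
Arguments Terminal {V N} b.

Definition bdd_node_map (V N N' : Type) (s : N -> N') (k : bdd_node V N) :
    bdd_node V N' :=
  match k with
  | Terminal b => Terminal b
  | Decision v l h => Decision v (s l) (s h)
  end.

Record bdd (V : Type) := Bdd {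
  node : finType;
  bdd_root : node;
  kind : node -> bdd_node V node }.

Definition children (V : Type) (B : bdd V) (u : node B) : seq (node B) :=
  if kind u is Decision _ l h then [:: l; h] else [::].

Definition reachable (V : Type) (B : bdd V) : rel (node B) :=
  connect (grel (@children V B)).

Inductive bdd_eval (V : finType) (B : bdd V) (x : {ffun V -> bool}) :
    node B -> bool -> Prop :=
  | EvalTerminal u b : kind u = Terminal b -> bdd_eval x u b
  | EvalDecision u v l h b : kind u = Decision v l h ->
      bdd_eval x (if x v then h else l) b -> bdd_eval x u b.

Definition bdd_computes (V : finType) (B : bdd V)
    (f : {ffun V -> bool} -> bool) : Prop :=
  forall x, bdd_eval x (bdd_root B) (f x).

Definition variable_order (V : finType) (s : seq V) : Prop :=
  perm_eq s (enum V).

(* Strict increase of the variables along edges also forces acyclicity. *)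
Definition ordered (V : finType) (s : seq V) (B : bdd V) : Prop :=
  forall (u u' : node B) v l h v' l' h',
    kind u = Decision v l h -> kind u' = Decision v' l' h' ->
    u' \in children u -> index v s < index v' s.

Definition isomorphic_subdiagrams (V : Type) (B : bdd V) (u v : node B) :
    Prop :=
  exists s : node B -> node B,
    [/\ s u = v,
        {in reachable u &, injective s},
        (forall w, reachable v w <-> exists2 w', reachable u w' & s w' = w) &
        {in reachable u, forall w, kind (s w) = bdd_node_map s (kind w)}].

Definition reduced (V : Type) (B : bdd V) : Prop :=
  (forall (u : node B) v l h, kind u = Decision v l h -> l <> h) /\
  (forall u v : node B, isomorphic_subdiagrams u v -> u = v).

(* [B] is, up to isomorphism, the ROBDD of [f] for the variable ordering [s].
   A terminal node is present only if it is reachable, so that constant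
   functions have a one-node ROBDD. *)
Definition is_robdd (V : finType) (s : seq V) (f : {ffun V -> bool} -> bool)
    (B : bdd V) : Prop :=
  [/\ forall u, reachable (bdd_root B) u,
      ordered s B,
      reduced B &
      bdd_computes B f].

Definition bdd_size (V : Type) (B : bdd V) : nat := #|node B|.

(** * Subset sum instances and their pseudo-Boolean constraints *)

Record subset_sum := SubsetSum {
  target : int;
  items : {fset nat};
  items_pos : 0 \notin items }.

Definition satisfiable (I : subset_sum) : Prop :=
  exists T : {fset nat}, (T `<=` items I)%fset /\ Posz (\sum_(a <- T) a) = target I.

(* The variables are the elements of [items I], the coefficient of the variable
   [a] being the number [a] itself. *)
Definition pb_constraint (I : subset_sum) (x : {ffun items I -> bool}) : bool :=
  (Posz (\sum_(a : items I) val a * x a) <= target I)%R.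

Definition bit_length (n : nat) : nat := (trunc_log 2 n).+1.

(* One extra bit for the sign of the target. *)
Definition instance_size (I : subset_sum) : nat :=
  (bit_length `|target I|).+1 + \sum_(a <- items I) bit_length a.

(* Main.v *)
(** Take the m^2 even numbers 2 (2^i + 2^m 2^j), i, j < m, one for each cell of
    an m x m grid, and the odd target 2^(2m+1) - 1, so that no subset sums to
    the target.  A perfect matching of rows with columns has the largest even
    sum below the target.  Cut a variable order in the middle and call A the
    set of cells above the cut.  The trace of a matching, i.e. the rows and the
    columns it matches inside A, can be read off in binary from its sum over A;
    if two matchings have different traces, then completing the heavier upper
    part by the other lower part exceeds the target, so the two matchings lead
    to different nodes at the cut.  While fewer than m/8 disjoint 2 x 2
    submatrices have been removed, neither A nor its complement contains the
    rest of the grid, which hence has a 2 x 2 submatrix on which A is not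
    constant, and its two perfect matchings leave different traces.  This gives
    2^(m/8) traces, whereas the bit length of the instance is cubic in m. *)

Require Import Defs.
From mathcomp Require Import all_boot all_order all_algebra finmap.
From mathcomp Require Import boolp classical_sets.
From mathcomp Require Import zify.
(* [classical_sets] shadows names such as [set0] and [subsetP]. *)
From mathcomp Require Import fintype finset.

Set Implicit Arguments.
Unset Strict Implicit.
Unset Printing Implicit Defensive.

Import Order.TTheory GRing.Theory Num.Theory.

Local Open Scope nat_scope.

(** * Fooling sets for ordered BDDs cut after [n] variables *)

Section Fooling.

Variables (V : finType) (s : seq V) (B : bdd V) (n : nat).
Hypothesis ordB : ordered s B.

Definition splice (x y : {ffun V -> bool}) : {ffun V -> bool} :=
  [ffun v => if index v s < n then x v else y v].

Definition below_cut (u : node B) : Prop :=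
  forall v l h, kind u = Decision v l h -> n <= index v s.

Lemma bdd_eval_fun (x : {ffun V -> bool}) (u : node B) b c :
  bdd_eval x u b -> bdd_eval x u c -> b = c.
Proof.
move=> ub; elim: ub c => {u b} [u b ku|u v l h b ku _ IH] c uc.
  by case: uc ku => [w d -> [->]|w v l h d -> _].
by case: uc ku IH => [w d ->//|w v' l' h' d -> wd [<- <- <-] IH]; apply: IH.
Qed.

(** By orderedness, evaluation from a node below the cut tests only variables at positions from [n]
    on, where the spliced assignment agrees with [x]. *)
Lemma bdd_eval_below_cut (x y : {ffun V -> bool}) (u : node B) b :
  below_cut u -> bdd_eval x u b -> bdd_eval (splice y x) u b.
Proof.
move=> cutu ub; elim: ub cutu => {u b} [u b ku _|u v l h b ku _ IH cutu].
  exact: EvalTerminal ku.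
apply: (EvalDecision ku).
have nv := cutu _ _ _ ku; rewrite ffunE ltnNge nv /=.
apply: IH => v' l' h' ku'; apply: leq_trans nv (ltnW _).
apply: (ordB ku ku'); rewrite /children ku.
by case: (x v); rewrite !inE eqxx ?orbT.
Qed.

(** The node [w] is the first one below the cut on the evaluation path of [x]; terminals count as
    below it, so [w] exists. The path down to [w] tests only variables above the cut, hence
    [splice x y] follows it too. *)
Lemma cut_node (x : {ffun V -> bool}) (u : node B) b :
  bdd_eval x u b -> exists w, [/\ below_cut w, bdd_eval x w b &
    forall y c, bdd_eval (splice x y) w c -> bdd_eval (splice x y) u c].
Proof.
elim=> {u b} [u b ku|u v l h b ku ub [w [cutw wb IH]]].
  by exists u; split=> // [v l h|]; [rewrite ku|exact: EvalTerminal ku].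
have [nv|vn] := leqP n (index v s).
  exists u; split=> //; last exact: EvalDecision ku ub.
  by move=> v' l' h'; rewrite ku => -[<-].
by exists w; split=> // y c /IH; rewrite [X in X -> _]/= => wc;
   apply: (EvalDecision ku); rewrite ffunE vn.
Qed.

(* Two assignments that reach the same node at the cut may exchange the values
   they give to the variables above it. *)
Lemma fooling_set (f : {ffun V -> bool} -> bool) (T : finType) (Z : {set T})
    (x : T -> {ffun V -> bool}) :
  bdd_computes B f ->
  {in Z &, forall z z', z != z' ->
     f (splice (x z') (x z)) != f (x z) \/ f (splice (x z) (x z')) != f (x z')} ->
  #|Z| <= bdd_size B.
Proof.
move=> Bf fool.
have /choice [w wP] := fun z => cut_node (Bf (x z)).
have swap z z' : w z = w z' -> f (splice (x z') (x z)) = f (x z).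
  move=> ww; have [cutw wb _] := wP z; have [_ _ IH] := wP z'.
  have := IH (x z) (f (x z)); rewrite -ww => /(_ (bdd_eval_below_cut _ cutw wb)).
  exact: bdd_eval_fun (Bf _).
rewrite -(card_in_imset (f := w)) ?max_card// => z z' Zz Zz' ww.
apply/eqP/contraT => /(fool z z' Zz Zz').
by rewrite (swap z z' ww) (swap z' z (esym ww)) !eqxx => -[].
Qed.

End Fooling.

(** * Matchings and the number of their traces on a set of cells *)

Section Matchings.

Variable I : finType.
Implicit Types (X Y : {set I}) (M A : {set I * I}).

Definition rows M : {set I} := fst @: M.

Definition cols M : {set I} := snd @: M.

(** Such an [M] is the graph of a bijection from [X] onto [Y]. *)
Definition matching X Y M : bool :=
  [&& rows M == X, cols M == Y, dinjectiveb fst (mem M) & dinjectiveb snd (mem M)].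

Lemma matching0 : matching set0 set0 set0.
Proof.
by rewrite /matching /rows /cols !imset0 !eqxx /=; apply/andP; split;
  apply/dinjectiveP => e e'; rewrite inE.
Qed.

Lemma matchingU1 X Y M i j : i \notin X -> j \notin Y -> matching X Y M ->
  matching (i |: X) (j |: Y) ((i, j) |: M).
Proof.
move=> iX jY /and4P [/eqP eX /eqP eY /dinjectiveP inj1 /dinjectiveP inj2].
apply/and4P; split.
- by rewrite /rows /cols imsetU1 -eX.
- by rewrite /rows /cols imsetU1 -eY.
- apply/dinjectiveP => e e'; rewrite !inE.
  case/predU1P=> [->|Me] /predU1P [->|Me'] //= E; last exact: inj1.
    by case/negP: iX; rewrite -eX E imset_f.
  by case/negP: iX; rewrite -eX -E imset_f.
- apply/dinjectiveP => e e'; rewrite !inE.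
  case/predU1P=> [->|Me] /predU1P [->|Me'] //= E; last exact: inj2.
    by case/negP: jY; rewrite -eY E imset_f.
  by case/negP: jY; rewrite -eY -E imset_f.
Qed.

Lemma matching_exists X Y : #|X| = #|Y| -> exists M, matching X Y M.
Proof.
move: {2}#|X| (erefl #|X|) => n; elim: n X Y => [|n IH] X Y cX XY.
  have -> : X = set0 by apply/eqP; rewrite -cards_eq0 cX.
  have -> : Y = set0 by apply/eqP; rewrite -cards_eq0 -XY cX.
  by exists set0; exact: matching0.
have /card_gt0P [i iX] : 0 < #|X| by rewrite cX.
have /card_gt0P [j jY] : 0 < #|Y| by rewrite -XY cX.
have cX' : #|X :\ i| = n by have := cardsD1 i X; rewrite iX cX => -[].
have cY' : #|Y :\ j| = n by have := cardsD1 j Y; rewrite jY -XY cX => -[].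
have [M mM] := IH (X :\ i) (Y :\ j) cX' (etrans cX' (esym cY')).
exists ((i, j) |: M); rewrite -(setD1K iX) -(setD1K jY).
by apply: matchingU1; rewrite ?setD11.
Qed.

Definition trace A M : {set I} * {set I} := (rows (M :&: A), cols (M :&: A)).

Definition traces A X Y : {set {set I} * {set I}} :=
  [set trace A M | M in [pred M | matching X Y M]].

Lemma trace_sub A X Y M : matching X Y M ->
  ((trace A M).1 \subset X) && ((trace A M).2 \subset Y).
Proof.
by case/and4P=> /eqP <- /eqP <- _ _; rewrite !imsetS ?subsetIl.
Qed.

Definition add_trace A (e : I * I) (t : {set I} * {set I}) :=
  if e \in A then (e.1 |: t.1, e.2 |: t.2) else t.

Lemma trace_U1 A M e : trace A (e |: M) = add_trace A e (trace A M).
Proof.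
rewrite /trace /add_trace /rows /cols setIUl; case: ifP => eA.
  have -> : [set e] :&: A = [set e] by apply/setIidPl; rewrite sub1set.
  by rewrite !imsetU1.
suff -> : [set e] :&: A = set0 by rewrite set0U.
by apply/setP => z; rewrite !inE; apply/negP => /andP [/eqP ->]; rewrite eA.
Qed.

Lemma add_trace1 A e t x : (x \in (add_trace A e t).1) =
  ((e \in A) && (x == e.1)) || (x \in t.1).
Proof. by rewrite /add_trace; case: ifP => eA; rewrite ?inE. Qed.

Lemma add_trace2 A e t x : (x \in (add_trace A e t).2) =
  ((e \in A) && (x == e.2)) || (x \in t.2).
Proof. by rewrite /add_trace; case: ifP => eA; rewrite ?inE. Qed.

(** The three equalities link all four cells, so their failure means that [A] is not constant on the
    2 x 2 submatrix. *)
Definition mixed A (i i' j j' : I) : bool :=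
  ~~ [&& ((i, j) \in A) == ((i, j') \in A), ((i', j) \in A) == ((i', j') \in A)
       & ((i, j) \in A) == ((i', j) \in A)].

(** Used with [b] and [d] for equality with the two new lines, [a] and [c] for their cells lying in
    [A], and [p] and [q] for membership in old traces, which avoid the new lines. *)
Fact union_cancel (a b c d p q : bool) :
  (p -> ~~ b && ~~ d) -> (q -> ~~ b && ~~ d) ->
  (a && b) || ((c && d) || p) = (a && b) || ((c && d) || q) -> p = q.
Proof.
case: p; case: q => //=.
  by move=> /(_ isT) /andP [/negbTE -> /negbTE ->] _; rewrite !andbF.
by move=> _ /(_ isT) /andP [/negbTE -> /negbTE ->]; rewrite !andbF.
Qed.

(** A matching of the smaller grid extends by the diagonal or by the antidiagonal of the submatrix.
    Each extension is injective on traces, since old traces avoid the removed lines, and the two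
    families of new traces are disjoint because [A] is mixed. *)
Lemma traces_double A X Y i i' j j' :
  i \in X -> i' \in X -> i != i' -> j \in Y -> j' \in Y -> j != j' ->
  mixed A i i' j j' ->
  2 * #|traces A (X :\ i :\ i') (Y :\ j :\ j')| <= #|traces A X Y|.
Proof.
move=> iX iX' ii' jY jY' jj' mix.
set X' := X :\ i :\ i'; set Y' := Y :\ j :\ j'.
have eX : i |: (i' |: X') = X by rewrite setD1K ?setD1K// !inE eq_sym ii'.
have eY : j |: (j' |: Y') = Y by rewrite setD1K ?setD1K// !inE eq_sym jj'.
(* The antidiagonal extension adds the two columns in the opposite order. *)
have eY' : j' |: (j |: Y') = Y by rewrite setUCA.
pose f1 t := add_trace A (i, j) (add_trace A (i', j') t).
pose f2 t := add_trace A (i, j') (add_trace A (i', j) t).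
have subT t : t \in traces A X' Y' ->
    (forall x, x \in t.1 -> (x != i) && (x != i')) /\
    (forall x, x \in t.2 -> (x != j) && (x != j')).
  case/imsetP=> M mM ->; have /andP [/subsetP s1 /subsetP s2] := trace_sub A mM.
  by split=> x; [move/s1|move/s2]; rewrite !inE => /and3P [-> ->].
have injf f : f = f1 \/ f = f2 -> {in traces A X' Y' &, injective f}.
  move=> ff t t' /subT [t1 t2] /subT [t1' t2'] E.
  have E1 x : (x \in (f t).1) = (x \in (f t').1) by rewrite E.
  have E2 x : (x \in (f t).2) = (x \in (f t').2) by rewrite E.
  rewrite (surjective_pairing t) (surjective_pairing t'); congr (_, _).
    apply/setP => x; move: (E1 x); case: ff => ->; rewrite !add_trace1 /=;
    by apply: union_cancel => [/t1|/t1'] /andP [-> ->].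
  apply/setP => x; move: (E2 x); case: ff => ->; rewrite !add_trace2 /=;
  by apply: union_cancel => [/t2|/t2'] /andP [-> ->].
have dis : [disjoint f1 @: traces A X' Y' & f2 @: traces A X' Y'].
  apply/pred0P => T /=; apply/negP => /andP [/imsetP [t /subT [t1 t2] ->]].
  move=> /imsetP [t' /subT [t1' t2'] E] {T}.
  have E1 x : (x \in (f1 t).1) = (x \in (f2 t').1) by rewrite E.
  have E2 x : (x \in (f1 t).2) = (x \in (f2 t').2) by rewrite E.
  have notin (S : {set I}) x (P : bool) : (x \in S -> P) -> ~~ P -> (x \in S) = false.
    by move=> SP nP; apply/negbTE/(contra _ nP).
  (* Comparing equal traces at [i], [i'] and [j] yields exactly the three equalities that [mixed]
     denies. *)
  have Ei := E1 i; have Ei' := E1 i'; have Ej := E2 j.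
  move: Ei Ei' Ej mix; rewrite !add_trace1 !add_trace2 /=.
  rewrite (notin _ _ _ (t1 i)) ?(notin _ _ _ (t1 i')) ?negb_and ?negbK ?eqxx ?orbT//.
  rewrite (notin _ _ _ (t1' i)) ?(notin _ _ _ (t1' i')) ?negb_and ?negbK ?eqxx ?orbT//.
  rewrite (notin _ _ _ (t2 j)) ?(notin _ _ _ (t2' j)) ?negb_and ?negbK ?eqxx ?orbT//.
  rewrite (negbTE ii') (eq_sym i') (negbTE ii') (negbTE jj') ?andbF ?andbT ?orbF /=.
  by rewrite /mixed => -> -> ->; rewrite !eqxx.
have sub : f1 @: traces A X' Y' :|: f2 @: traces A X' Y' \subset traces A X Y.
  apply/subsetP => z; rewrite inE => /orP [] /imsetP [t /imsetP [M mM ->] ->];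
    rewrite /f1 /f2 -!trace_U1; apply: imset_f; rewrite inE -eX -?eY.
    by do 2?apply: matchingU1 => //; rewrite !inE ?eqxx ?andbF ?(negbTE ii') ?(negbTE jj').
  rewrite eY -eY'.
  by do 2?apply: matchingU1 => //;
     rewrite !inE ?eqxx ?andbF ?(negbTE ii') 1?eq_sym ?(negbTE jj').
apply: leq_trans (subset_leq_card sub).
rewrite cardsU; have /eqP -> : f1 @: traces A X' Y' :&: f2 @: traces A X' Y' == set0.
  by rewrite setI_eq0.
rewrite cards0 subn0 (card_in_imset (injf f1 (or_introl erefl))).
by rewrite (card_in_imset (injf f2 (or_intror erefl))) mul2n addnn.
Qed.

Lemma mixed_exists A X Y : 1 < #|X| -> 1 < #|Y| ->
  #|A| < #|X| * #|Y| -> #|~: A| < #|X| * #|Y| ->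
  exists i i' j j', [/\ i \in X, i' \in X & i != i'] /\
    [/\ j \in Y, j' \in Y, j != j' & mixed A i i' j j'].
Proof.
rewrite -!cardsX => X1 Y1 cA cA'.
have other (S : {set I}) x : 1 < #|S| -> exists2 y, y \in S & x != y.
  rewrite (cardsD1 x) => S1; have /card_gt0P [y] : 0 < #|S :\ x|.
    by move: S1; case: (x \in S) => //=; case: #|_|.
  by rewrite !inE eq_sym => /andP [xy yS]; exists y.
have /subsetPn [[a b]] : ~~ (finset.setX X Y \subset A).
  by apply: contraL cA => /subset_leq_card; rewrite -leqNgt.
have /subsetPn [[c d]] : ~~ (finset.setX X Y \subset ~: A).
  by apply: contraL cA' => /subset_leq_card; rewrite -leqNgt.
rewrite !inE /= negbK => /andP [cX dY] cdA /andP [aX bY] abA.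
(* The cell [(a, b)] is outside [A] and [(c, d)] inside. If they share no line they are opposite
   corners of a mixed submatrix; if they share one, any further parallel line completes it. *)
have [ac|ac] := eqVneq a c; last first.
  have [bd|bd] := eqVneq b d; last first.
    exists a, c, b, d; split; split=> //; rewrite /mixed (negbTE abA) cdA.
    by case: (_ \in _); case: (_ \in _).
  have [e eY be] := other Y b Y1.
  exists a, c, b, e; split; split=> //; rewrite /mixed (negbTE abA) bd cdA.
  by rewrite !andbF.
have [e eX ae] := other X a X1.
exists a, e, b, d; split; split=> //.
  by apply: contraNneq abA => ->; rewrite ac.
by rewrite /mixed (negbTE abA) ac cdA.
Qed.

(** Each removal of two rows and two columns contributes a factor 2. As long as one remains to be
    done, the sides are at least [r + 2], so neither [A] nor its complement can cover the grid that
    is left. *)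
Lemma card_traces A X Y r k : #|X| = r + 2 * k -> #|Y| = r + 2 * k ->
  #|A| < (r + 2) ^ 2 -> #|~: A| < (r + 2) ^ 2 -> 2 ^ k <= #|traces A X Y|.
Proof.
move=> + + cA cA'; elim: k X Y => [|k IH] X Y cX cY.
  have [M mM] := matching_exists (etrans cX (esym cY)).
  by apply/card_gt0P; exists (trace A M); apply: imset_f.
have big : (r + 2) ^ 2 <= #|X| * #|Y| by rewrite cX cY -mulnn leq_mul //; lia.
have [||||i [i' [j [j' [[iX iX' ii'] [jY jY' jj' mix]]]]]] := @mixed_exists A X Y.
- by rewrite cX; lia.
- by rewrite cY; lia.
- exact: leq_trans cA big.
- exact: leq_trans cA' big.
apply: leq_trans (traces_double iX iX' ii' jY jY' jj' mix).
rewrite expnS leq_mul2l; apply: IH.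
  have := cardsD1 i' (X :\ i); have := cardsD1 i X.
  by rewrite !inE iX iX' eq_sym ii' cX; lia.
have := cardsD1 j' (Y :\ j); have := cardsD1 j Y.
by rewrite !inE jY jY' eq_sym jj' cY; lia.
Qed.

End Matchings.

(** * Sets of indices as binary numbers *)

Lemma bits_lt n (b : 'I_n -> bool) : \sum_(i < n) b i * 2 ^ i < 2 ^ n.
Proof.
elim: n b => [|n IH] b; first by rewrite big_ord0.
rewrite big_ord_recr expnS /=; have := IH (fun i => b (widen_ord (leqnSn n) i)).
by case: (b ord_max) => /=; rewrite ?mul1n ?mul0n; lia.
Qed.

Lemma bits_inj n (b c : 'I_n -> bool) :
  \sum_(i < n) b i * 2 ^ i = \sum_(i < n) c i * 2 ^ i -> b =1 c.
Proof.
elim: n b c => [|n IH] b c; first by move=> _ [].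
pose W := widen_ord (leqnSn n).
rewrite !big_ord_recr /= -/W => E.
have ltb : \sum_(i < n) b (W i) * 2 ^ i < 2 ^ n := bits_lt (b \o W).
have ltc : \sum_(i < n) c (W i) * 2 ^ i < 2 ^ n := bits_lt (c \o W).
have top : b ord_max = c ord_max.
  by move: E ltc ltb; case: (b ord_max); case: (c ord_max) => //=; rewrite ?mul1n ?mul0n; lia.
have {}IH : b \o W =1 c \o W by apply: IH; move: E; rewrite top => /addIn.
move=> i; have [lin|nli] := ltnP i n.
  have -> : i = W (Ordinal lin) by apply: val_inj.
  exact: IH.
have -> : i = ord_max by apply/val_inj/eqP; rewrite eqn_leq nli -ltnS ltn_ord.
exact: top.
Qed.

Lemma binary_set_lt n (S : {set 'I_n}) : \sum_(i in S) 2 ^ i < 2 ^ n.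
Proof.
apply: leq_ltn_trans (bits_lt (mem S)); rewrite big_mkcond leq_sum// => i _.
by case: ifP => iS; rewrite inE iS ?mul1n.
Qed.

Lemma binary_set_inj n : injective (fun S : {set 'I_n} => \sum_(i in S) 2 ^ i).
Proof.
move=> S T /=; rewrite big_mkcond [RHS]big_mkcond /= => E.
apply/setP; apply: bits_inj.
rewrite (eq_bigr (fun i => if i \in S then 2 ^ i else 0)); last first.
  by move=> i _; case: ifP; rewrite ?mul1n.
by rewrite E; apply: eq_bigr => i _; case: ifP; rewrite ?mul1n.
Qed.

Lemma binary_setT n : \sum_(i in [set: 'I_n]) 2 ^ i = (2 ^ n).-1.
Proof.
by rewrite predn_exp mul1n; apply: eq_bigl => i; rewrite inE.
Qed.

(** * The grid instance and the size of its ROBDDs *)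

Section Grid.

Variable m : nat.
Notation cell := ('I_m * 'I_m)%type.
Implicit Types (e : cell) (M N A : {set cell}).

Definition cell_weight e : nat := 2 * (2 ^ e.1 + 2 ^ m * 2 ^ e.2).

Definition grid_target : nat := (2 ^ (2 * m).+1).-1.

Definition grid_items : {fset nat} := [fset cell_weight e | e in {: cell}]%fset.

Lemma cell_weight_gt0 e : 0 < cell_weight e.
Proof. by rewrite /cell_weight muln_gt0 addn_gt0 expn_gt0. Qed.

Lemma grid_items_pos : 0 \notin grid_items.
Proof.
by apply/imfsetP => -[e _ E]; have := cell_weight_gt0 e; rewrite -E.
Qed.

Definition grid : subset_sum := SubsetSum (Posz grid_target) grid_items_pos.

Lemma cell_weight_in e : cell_weight e \in grid_items.
Proof. by apply/imfsetP; exists e. Qed.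

Definition cell_item e : items grid := [` cell_weight_in e]%fset.

Lemma grid_unsat : ~ satisfiable grid.
Proof.
case=> T [/fsubsetP subT [E]].
have : odd grid_target by rewrite /grid_target -subn1 oddB ?expn_gt0// oddX.
apply/negP; rewrite -E -dvdn2 big_seq; apply: dvdn_sum => a /subT /imfsetP [e _ ->].
exact: dvdn_mulr.
Qed.

Lemma cell_weight_binary M : {in M &, injective fst} -> {in M &, injective snd} ->
  \sum_(e in M) cell_weight e =
  2 * (\sum_(i in rows M) 2 ^ i + 2 ^ m * \sum_(j in cols M) 2 ^ j).
Proof.
move=> i1 i2; rewrite /rows /cols !big_imset//.
by rewrite -big_distrr /= big_split /= big_distrr.
Qed.

(** Half of the sum is a two-digit number in base [2 ^ m]: the rows give the low digit and the
    columns the high one, without carries because no line occurs twice. Remainder and quotient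
    recover both. *)
Lemma cell_weight_inj M N :
  {in M &, injective fst} -> {in M &, injective snd} ->
  {in N &, injective fst} -> {in N &, injective snd} ->
  \sum_(e in M) cell_weight e = \sum_(e in N) cell_weight e ->
  rows M = rows N /\ cols M = cols N.
Proof.
move=> M1 M2 N1 N2.
rewrite !cell_weight_binary// => /eqP; rewrite eqn_mul2l /= => /eqP E.
have := congr1 (modn^~ (2 ^ m)) E; have := congr1 (divn^~ (2 ^ m)) E.
rewrite /= ![_ + 2 ^ m * _]addnC ![2 ^ m * _]mulnC !modnMDl.
rewrite !divnMDl ?expn_gt0// ![_ %% _]modn_small ?binary_set_lt//.
rewrite ![(\sum_(_ in rows _) _) %/ _]divn_small ?binary_set_lt// !addn0.
by move=> /binary_set_inj e2 /binary_set_inj e1.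
Qed.

Lemma matching_trace_inj A X Y M N : matching X Y M -> matching X Y N ->
  \sum_(e in M :&: A) cell_weight e = \sum_(e in N :&: A) cell_weight e ->
  trace A M = trace A N.
Proof.
have inj M' : matching X Y M' ->
    {in M' :&: A &, injective fst} /\ {in M' :&: A &, injective snd}.
  case/and4P=> _ _ /dinjectiveP i1 /dinjectiveP i2.
  by split=> e e' /setIP [eM _] /setIP [eM' _]; [apply: i1|apply: i2].
move=> /inj [M1 M2] /inj [N1 N2] /cell_weight_inj [] // e1 e2.
by rewrite /trace e1 e2.
Qed.

Lemma cell_weight_matching M : matching setT setT M ->
  \sum_(e in M) cell_weight e = grid_target.-1.
Proof.
case/and4P=> /eqP e1 /eqP e2 /dinjectiveP i1 /dinjectiveP i2.
rewrite cell_weight_binary// e1 e2 binary_setT /grid_target.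
have : 0 < 2 ^ m by rewrite expn_gt0.
by rewrite expnS [2 * m]mul2n -addnn expnD; nia.
Qed.

(** A single cell is a partial matching, so its weight determines its row and column. *)
Lemma cell_item_inj : injective cell_item.
Proof.
have inj1 T (f : cell -> T) e : {in [set e] &, injective f}.
  by move=> x y /set1P -> /set1P ->.
move=> e e' /(congr1 val) /= E.
have [|||||] := @cell_weight_inj [set e] [set e'];
  rewrite ?big_set1 ?/rows ?/cols ?imset_set1//.
by case: e e' {E} => [i j] [i' j'] /= /set1_inj -> /set1_inj ->.
Qed.

Lemma cell_item_bij : bijective cell_item.
Proof.
apply: (inj_card_bij cell_item_inj); rewrite -(card_codom cell_item_inj).
apply: subset_leq_card; apply/subsetP => a _; apply/codomP.
have /imfsetP [e _ E] := valP a; exists e; exact: val_inj.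
Qed.

Lemma grid_size : 0 < m -> instance_size grid <= 8 * m ^ 3.
Proof.
move=> m0.
have bits a : 0 < a -> a < 2 ^ (2 * m).+1 -> bit_length a <= (2 * m).+1.
  move=> a0 lta; rewrite /bit_length -(ltn_exp2l _ _ (ltnSn 1)).
  exact: leq_ltn_trans (trunc_logP (ltnSn 1) a0) lta.
have bitsS : \sum_(a <- items grid) bit_length a <= m ^ 2 * (2 * m).+1.
  apply: (@leq_trans (\sum_(a <- items grid) (2 * m).+1)).
    rewrite big_seq [leqRHS]big_seq; apply: leq_sum => a /imfsetP [e _ ->].
    apply: bits; first exact: cell_weight_gt0.
    rewrite expnS ltn_pmul2l// mul2n -addnn expnD.
    have := ltn_ord e.1; have := ltn_ord e.2.
    have le i : i < m -> 2 * 2 ^ i <= 2 ^ m by rewrite -expnS leq_exp2l.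
    move=> /le l1 /le l2; have : 0 < 2 ^ e.1 by rewrite expn_gt0.
    move: l1 l2; move: (2 ^ e.1) (2 ^ e.2) (2 ^ m) => {}a b x xb xa a0.
    (* Both [a] and [b] are at most [x / 2] and [x] is at least 2, so [a + x * b] stays below
       [x * x]. *)
    have := leq_mul (leqnn x) xb; have : 2 * x <= x * x by rewrite leq_mul2r; lia.
    by nia.
  rewrite big_const_seq count_predT iter_addn_0 mulnC leq_mul2r; apply/orP; right.
  apply: leq_trans (leq_imfset_card _ _ _) _.
  by rewrite -cardT card_prod card_ord mulnn.
have bitsT : bit_length `|Posz grid_target| <= (2 * m).+1.
  apply: bits; rewrite /grid_target /=.
    by have : 0 < 2 ^ (2 * m); rewrite ?expn_gt0// expnS; lia.
  by rewrite prednK ?expn_gt0.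
rewrite /instance_size; move: bitsT bitsS; rewrite /=; set x := bit_length _.
by set y := \sum_(a <- _) _; nia.
Qed.

Definition load (x : {ffun items grid -> bool}) : nat :=
  \sum_(a : items grid) val a * x a.

Lemma pb_constraintE x : @pb_constraint grid x = (load x <= grid_target).
Proof. by []. Qed.

Definition indicator M : {ffun items grid -> bool} := [ffun a => a \in cell_item @: M].

Lemma load_splice (s : seq (items grid)) n M N :
  let A := [set e | index (cell_item e) s < n] in
  load (splice s n (indicator M) (indicator N)) =
  \sum_(e in M :&: A) cell_weight e + \sum_(e in N :\: A) cell_weight e.
Proof.
move=> A; rewrite /load (reindex cell_item) /=; last exact/onW_bij/cell_item_bij.
rewrite [X in _ = X + _]big_mkcond [X in _ = _ + X]big_mkcond -big_split.
apply: eq_bigr => e _ /=.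
rewrite !ffunE !(mem_imset _ _ cell_item_inj) !inE.
move: (cell_weight e) => w; case: (index _ _ < n); case: (e \in M);
  by case: (e \in N); rewrite /= ?muln0 ?muln1 ?addn0.
Qed.

Lemma card_prefix (s : seq (items grid)) n : variable_order s -> n <= m ^ 2 ->
  #|[set e | index (cell_item e) s < n]| = n.
Proof.
move=> sV nm.
have us : uniq s by rewrite (perm_uniq sV) enum_uniq.
have ss : size s = m ^ 2.
  by rewrite (perm_size sV) -cardT -(bij_eq_card cell_item_bij) card_prod card_ord.
rewrite -(card_imset _ cell_item_inj).
rewrite -[RHS](size_takel (s := s)) ?ss// -(card_uniqP (take_uniq n us)).
apply: eq_card => a; have [g _ gK] := cell_item_bij.
have as' : a \in s by rewrite (perm_mem sV) mem_enum.
rewrite -(gK a) (mem_imset _ _ cell_item_inj) inE in_take// gK //.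
Qed.

Lemma grid_robdd_size k (s : seq (items grid)) (B : bdd (items grid)) :
  m = 8 * k -> variable_order s -> is_robdd s (@pb_constraint grid) B ->
  2 ^ k <= bdd_size B.
Proof.
move=> mk sV [_ ordB _ Bf].
(* Half of the [64 * k ^ 2] cells. *)
pose n := 32 * k ^ 2.
have nm : n <= m ^ 2 by rewrite /n mk; lia.
pose A := [set e | index (cell_item e) s < n].
have cA : #|A| = n by apply: card_prefix.
have cT : #|[set: 'I_m]| = 6 * k + 2 * k by rewrite cardsT card_ord mk; lia.
apply: (@leq_trans #|traces A setT setT|).
  (* After [k] removals a side is still [6 * k], and [36 * k ^ 2] already bounds either half. *)
  have small : n < (6 * k + 2) ^ 2 by rewrite /n -!mulnn; nia.
  have cA' : #|~: A| = n.
    by have := cardsC A; rewrite cA card_prod card_ord /n -!mulnn; move: mk; clear; nia.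
  by apply: (card_traces cT cT); rewrite ?cA ?cA'.
(* One matching is chosen per trace; the default [set0] never occurs for an actual trace. *)
pose rep t := odflt set0 [pick M | matching setT setT M && (trace A M == t)].
have repP t : t \in traces A setT setT ->
    matching setT setT (rep t) /\ trace A (rep t) = t.
  case/imsetP=> M mM ->; rewrite /rep; case: pickP => [N /andP [? /eqP]|/(_ M)] //.
  by rewrite eqxx andbT; have -> : matching setT setT M by exact: mM.
apply: (fooling_set ordB (x := fun t => indicator (rep t)) Bf).
move=> t t' /repP [mt tt] /repP [mt' tt'] ne.
have same M : splice s n (indicator M) (indicator M) = indicator M.
  by apply/ffunP => a; rewrite ffunE if_same.
have full M : matching setT setT M -> load (indicator M) = grid_target.-1.
  by move=> mM; rewrite -(cell_weight_matching mM) -{1}same load_splice -big_setID.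
have lt M N : matching setT setT M -> matching setT setT N ->
    \sum_(e in M :&: A) cell_weight e < \sum_(e in N :&: A) cell_weight e ->
    pb_constraint (splice s n (indicator N) (indicator M)) != pb_constraint (indicator M).
  move=> mM mN ltMN.
  (* By parity the heavier upper part gains at least 2, which lifts the sum from [grid_target.-1]
     past the target. *)
  have even (P : {set cell}) : \sum_(e in P) cell_weight e =
      2 * \sum_(e in P) (2 ^ e.1 + 2 ^ m * 2 ^ e.2).
    by rewrite big_distrr.
  rewrite !pb_constraintE full// leq_pred load_splice -/A eqb_id -ltnNge.
  have := full _ mM; move: ltMN; rewrite -(same M) load_splice -/A !(even (_ :&: _)).
  have : 0 < grid_target by rewrite /grid_target -subn1 subn_gt0 -{1}(expn0 2) ltn_exp2l.
  lia.
have [lts|lts|eqs] := ltngtP (\sum_(e in rep t :&: A) cell_weight e)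
                             (\sum_(e in rep t' :&: A) cell_weight e).
- by left; apply: lt.
- by right; apply: lt.
by case/negP: ne; rewrite -tt -tt' (matching_trace_inj mt mt' eqs).
Qed.

End Grid.

(** * Exponential against polynomial growth, and the conclusion *)

Lemma horner_nat_le (p : {poly nat}) n : 0 < n ->
  p.[n]%R <= (\sum_(i < size p) p`_i)%R * n ^ size p.
Proof.
move=> n0; rewrite horner_coef.
have -> : (\sum_(i < size p) p`_i)%R * n ^ size p =
    (\sum_(i < size p) ((p`_i)%R * n ^ size p)%N)%R by exact: mulr_suml.
apply: (big_ind2 (fun a b : nat => a <= b)) => // [a b c d ab cd|i _].
  exact: leq_add.
by rewrite -natrXE leq_mul2l leq_pexp2l ?orbT// ltnW.
Qed.

Lemma exp_gt_poly C d : exists2 k, 0 < k & C * (8 * (8 * k) ^ 3) ^ d < 2 ^ k.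
Proof.
(* With [k] a power of 2, the claim reduces to comparing exponents: [C + (12 + 6 * r) * d] is at
   most [(r + 1) ^ 2], and hence at most [2 ^ (2 * r)]. *)
pose r := C + 12 * d; exists (2 ^ (2 * r)); first by rewrite expn_gt0.
have -> : 8 * (8 * 2 ^ (2 * r)) ^ 3 = 2 ^ (12 + 6 * r).
  by rewrite expnMn -expnM expnD mulnA; congr (_ * 2 ^ _); lia.
apply: (@leq_trans (2 ^ C * 2 ^ ((12 + 6 * r) * d))).
  by rewrite -expnM ltn_pmul2r ?expn_gt0// ltn_expl.
rewrite -expnD leq_exp2l// expnM.
apply: (@leq_trans (r.+1 ^ 2)); first by rewrite /r -mulnn; nia.
by rewrite -expnM mulnC expnM leq_exp2r// ltn_expl.
Qed.

Theorem mainTheorem1 (np_neq_conp : NP <> coNP) :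
  exists F : set subset_sum,
    (forall I : subset_sum, F I -> ~ satisfiable I) /\
    ~ (exists p : {poly nat}, forall I : subset_sum, F I ->
         exists s : seq (items I), variable_order s /\
           exists B : bdd (items I),
             is_robdd s (@pb_constraint I) B /\
             (bdd_size B <= (p.[instance_size I])%R)%N).
Proof.
(* Side lengths are multiples of 8, so that [m / 8] is exactly [k]. *)
exists (fun I => exists k, I = grid (8 * k)); split=> [I [k ->]|[p small]].
  exact: grid_unsat.
have [k k0] := exp_gt_poly (\sum_(i < size p) p`_i)%R (size p).
apply/negP; rewrite -leqNgt.
have [s [sV [B [robddB sizeB]]]] := small _ (ex_intro _ k erefl).
apply: leq_trans (grid_robdd_size erefl sV robddB) (leq_trans sizeB _).
apply: leq_trans (horner_nat_le _ _) _; first by rewrite /instance_size.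
apply: leq_mul => //; case: (size p) => // d.
by rewrite leq_exp2r// grid_size// muln_gt0.
Qed.
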